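(* We have $n_2(3,1,1)=n_2(3,2,1)=6$, $n_2(3,3,1)=n_2(3,4,1)=8$, $n_2(3,5,1)=11$, $n_2(3,6,1)=12$, $n_2(3,7,1)=14$, and $n_2(3,d,1)=n_2(3,d)$ for all $d\ge 8$.
   Context: An $[n,k,d]_q$-code is a $k$-dimensional subspace of $\mathbb{F}_q^n$ with minimum Hamming distance at least $d$. $n_q(k,d)$ denotes the minimum length $n$ of an $[n,k,d]_q$-code. A linear code $C\subseteq\mathbb{F}_q^n$ has locality $r$ if for every coordinate $i$ there is a set $S_i\subseteq\{1,\dots,n\}\setminus\{i\}$ with $|S_i|\le r$ such that any two codewords agreeing on all coordinates in $S_i$ also agree in coordinate $i$. $n_q(k,d,r)$ denotes the minimum length $n$ of an $[n,k,d]_q$-code with locality $r$. *)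

(* Defs.v *)
From HB Require Import structures.
From mathcomp Require Import all_boot all_order all_algebra.

Set Implicit Arguments.
Unset Strict Implicit.
Unset Printing Implicit Defensive.

Import GRing.Theory.

Section Codes.
Variable F : finFieldType.

Definition hamming_dist (n : nat) (u v : 'rV[F]_n) : nat :=
  #|[set i : 'I_n | u ord0 i != v ord0 i]|.

Definition min_dist_ge (n : nat) (C : {vspace 'rV[F]_n}) (d : nat) : Prop :=
  forall u v, u \in C -> v \in C -> u != v -> d <= hamming_dist u v.

Definition is_code (n k d : nat) (C : {vspace 'rV[F]_n}) : Prop :=
  \dim C = k /\ min_dist_ge C d.

Definition has_locality (n : nat) (C : {vspace 'rV[F]_n}) (r : nat) : Prop :=
  forall i : 'I_n, exists S : {set 'I_n},
    [/\ i \notin S, #|S| <= r &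
        forall u v, u \in C -> v \in C ->
          (forall j, j \in S -> u ord0 j = v ord0 j) -> u ord0 i = v ord0 i].

End Codes.

Definition is_minimum (P : nat -> Prop) (n : nat) : Prop :=
  P n /\ forall m, P m -> n <= m.

(* [min_length F k d n] reads "n_q(k,d) = n" and [min_length_loc F k d r n]
   reads "n_q(k,d,r) = n", where q = #|F|; being the minimum includes being
   attained. *)
Definition min_length (F : finFieldType) (k d n : nat) : Prop :=
  is_minimum (fun m => exists C : {vspace 'rV[F]_m}, is_code k d C) n.

Definition min_length_loc (F : finFieldType) (k d r n : nat) : Prop :=
  is_minimum
    (fun m => exists C : {vspace 'rV[F]_m}, is_code k d C /\ has_locality C r) n.

(* Main.v *)
Require Import Defs.
From HB Require Import structures.
From mathcomp Require Import all_boot all_order all_algebra.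
From mathcomp Require Import zify.

(** A binary code of dimension 3 is given by the multiplicities [x p] of the
    columns [p] of a generator matrix.  The codeword of index [a] has weight the
    sum of the [x p] with [a . p = 1], and the code has locality 1 iff no nonzero
    column has multiplicity exactly 1.  The lower bounds are thus integer
    inequalities in seven unknowns.  The upper bounds repeat cyclically a
    prefix of a suitable ordering of the seven nonzero columns. *)

Import GRing.Theory.

Set Implicit Arguments.
Unset Strict Implicit.
Unset Printing Implicit Defensive.

Local Open Scope ring_scope.

(** * Boolean vectors and the field of two elements *)

Definition bvec : finType := (bool * bool * bool)%type.

Definition bdot (a p : bvec) : bool :=
  (a.1.1 && p.1.1) (+) (a.1.2 && p.1.2) (+) (a.2 && p.2).

Definition bvec0 : bvec := (false, false, false).

Definition bvec_nth (a : bvec) (k : nat) : bool :=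
  nth false [:: a.1.1; a.1.2; a.2] k.

(** The test [x != 0] turns the operations of the field into xor and conjunction, so that
    coordinates of codewords become values of [bdot]. *)
Lemma F2_neq0D (x y : 'F_2) : (x + y != 0) = (x != 0) (+) (y != 0).
Proof. by case: x => [[|[|?]] ?] //; case: y => [[|[|?]] ?]. Qed.

Lemma F2_neq0M (x y : 'F_2) : (x * y != 0) = (x != 0) && (y != 0).
Proof. by rewrite mulf_eq0 negb_or. Qed.

Lemma F2_neq0_inj (x y : 'F_2) : (x != 0) = (y != 0) -> x = y.
Proof.
by case: x => [[|[|?]] ?] //; case: y => [[|[|?]] ?] // _; apply: val_inj.
Qed.

Lemma F2_nat_bool (b : bool) : (b%:R != 0 :> 'F_2) = b.
Proof. by case: b. Qed.

(** * From a code to its column multiplicities *)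

Section Multiplicities.

Variables (n : nat) (col : 'I_n -> bvec).

Definition mult (p : bvec) : nat := #|[set i | col i == p]|.

Lemma card_col_pred (P : pred bvec) :
  #|[set i | P (col i)]| = (\sum_(p | P p) mult p)%N.
Proof.
rewrite -sum1_card (partition_big col P) /=; last by move=> i; rewrite inE.
apply: eq_bigr => p Pp; rewrite /mult -sum1_card; apply: eq_bigl => i.
by rewrite !inE; case: eqP => [->|]; rewrite ?Pp ?andbF.
Qed.

End Multiplicities.

Section ColumnsOfCode.

Variables (n : nat) (C : {vspace 'rV['F_2]_n}).
Hypothesis dimC : \dim C = 3.

Let b (k : nat) : 'rV['F_2]_n := (vbasis C)`_k.

Let b_in k : b k \in C.
Proof.
have [lt_k|ge_k] := ltnP k (size (vbasis C)).
  by apply: vbasis_mem; apply: mem_nth.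
by rewrite /b nth_default ?mem0v.
Qed.

Definition code_col (i : 'I_n) : bvec :=
  (b 0 ord0 i != 0, b 1 ord0 i != 0, b 2 ord0 i != 0).

Let word (a : bvec) : 'rV['F_2]_n :=
  a.1.1%:R *: b 0 + a.1.2%:R *: b 1 + a.2%:R *: b 2.

Let word_in a : word a \in C.
Proof. by rewrite !memvD ?memvZ. Qed.

Let word_neq0 a : a != bvec0 -> word a != 0.
Proof.
apply: contra => /eqP w0.
have fX := basis_free (vbasisP C); move: (fX).
have sX : size (vbasis C) = 3 by rewrite size_tuple.
move: w0; rewrite /word /b.
case: (tval (vbasis C)) sX => [|v0 [|v1 [|v2 [|]]]] //= _ w0.
move/(@freeP _ _ 3 [tuple v0; v1; v2]) /(_ (fun k => (bvec_nth a k)%:R)).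
rewrite !big_ord_recl big_ord0 /= addr0 addrA => /(_ w0) k0.
have := (k0 0, k0 1, k0 (2%:R)); case: a {w0 k0} => [[[] []] []] //=.
all: by do !case.
Qed.

Let word_coor a i : (word a ord0 i != 0) = bdot a (code_col i).
Proof. by rewrite !mxE !F2_neq0D !F2_neq0M !F2_nat_bool. Qed.

Lemma code_weight d a : min_dist_ge C d -> a != bvec0 ->
  (d <= \sum_(p | bdot a p) mult code_col p)%N.
Proof.
move=> dC a0; rewrite -card_col_pred.
have := dC _ _ (word_in a) (mem0v C) (word_neq0 a0).
by rewrite /hamming_dist; under eq_finset => i do rewrite [X in _ != X]mxE word_coor.
Qed.

Lemma code_length : (\sum_p mult code_col p)%N = n.
Proof.
rewrite -(card_col_pred code_col predT) -[RHS]card_ord.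
by apply: eq_card => i; rewrite !inE.
Qed.

(** A coordinate [i] with nonzero column cannot be recovered from the empty set, so it is recovered
    from a single [j]. Then [j] has the same column as [i], which gives that column a second
    occurrence. *)
Lemma code_mult_neq1 p : has_locality C 1 -> p != bvec0 -> mult code_col p != 1.
Proof.
move=> locC p0; apply/negP => /cards1P[i /setP colp].
have ci : code_col i = p by apply/eqP; have := colp i; rewrite !inE eqxx.
have [S [iS cS locS]] := locC i.
have [k bki] : exists k, b k ord0 i != 0.
  move: p0; rewrite -ci /code_col.
  case E0: (b 0 ord0 i != 0); first by exists 0.
  case E1: (b 1 ord0 i != 0); first by exists 1.
  by case E2: (b 2 ord0 i != 0); first by exists 2.
have locS0 u : u \in C -> (forall j, j \in S -> u ord0 j = 0) -> u ord0 i = 0.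
  move=> uC u0; rewrite (locS u 0) ?mem0v ?mxE // => j jS.
  by rewrite u0 ?mxE.
have [j jS bkj] : exists2 j, j \in S & b k ord0 j != 0.
  apply/exists_inP; apply: contraR bki => /exists_inPn bk0.
  by apply/eqP/locS0 => // j /bk0; rewrite negbK => /eqP.
have SE : S = [set j].
  by apply/esym/eqP; rewrite eqEcard sub1set jS cards1.
(* Compare [b l] with the zero word if it vanishes at [j], and otherwise with [b k]: over two
   elements they then agree at [j], hence at [i]. *)
have eq_ij l : (b l ord0 j != 0) = (b l ord0 i != 0).
  have [bl0|blj] := eqVneq (b l ord0 j) 0.
    rewrite locS0 ?eqxx // => j'.
    by rewrite SE inE => /eqP->.
  rewrite (locS (b l) (b k)) ?bki // => j'.
  rewrite SE inE => /eqP->; apply: F2_neq0_inj.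
  by rewrite blj bkj.
have /esym := colp j; rewrite !inE -ci /code_col !eq_ij eqxx => /eqP ji.
by rewrite -ji jS in iS.
Qed.

End ColumnsOfCode.

(** * Integer inequalities and the Griesmer bound *)

Lemma big_bvec (P : pred bvec) (F : bvec -> nat) :
  (\sum_(p | P p) F p =
   \sum_(p <- [:: (false, false, false); (true, false, false); (false, true, false);
                  (true, true, false); (false, false, true); (true, false, true);
                  (false, true, true); (true, true, true)] | P p) F p)%N.
Proof.
apply: perm_big; apply: uniq_perm; rewrite ?index_enum_uniq //.
by move=> [[[] []] []]; rewrite mem_index_enum.
Qed.

(** The index of an unknown is its point of the Fano plane read in binary, first coordinate least
    significant. Each bound on [d] sums over the complement of a line. The length is only bounded
    below, since zero columns may occur. *)
Definition plane_bounds (n d x1 x2 x3 x4 x5 x6 x7 : nat) : Prop :=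
  (x1 + x2 + x3 + x4 + x5 + x6 + x7 <= n)%N /\
  (d <= x1 + x3 + x5 + x7)%N /\ (d <= x2 + x3 + x6 + x7)%N /\
  (d <= x1 + x2 + x5 + x6)%N /\ (d <= x4 + x5 + x6 + x7)%N /\
  (d <= x1 + x3 + x4 + x6)%N /\ (d <= x2 + x3 + x4 + x5)%N /\
  (d <= x1 + x2 + x4 + x7)%N.

Lemma code_plane_bounds n d (C : {vspace 'rV['F_2]_n}) : is_code 3 d C ->
  exists x1 x2 x3 x4 x5 x6 x7,
    plane_bounds n d x1 x2 x3 x4 x5 x6 x7 /\
    (has_locality C 1 -> all (fun x => x != 1)%N [:: x1; x2; x3; x4; x5; x6; x7]).
Proof.
move=> [dimC dC]; pose x := mult (code_col C).
exists (x (true, false, false)), (x (false, true, false)), (x (true, true, false)),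
  (x (false, false, true)), (x (true, false, true)), (x (false, true, true)),
  (x (true, true, true)).
split; last by move=> locC; rewrite /= /x !code_mult_neq1.
have := code_length C; rewrite big_bvec !big_cons big_nil /= -/x => nE.
have wt a := code_weight dimC dC (a := a); move: wt; rewrite -/x => wt.
have := wt (true, false, false); have := wt (false, true, false).
have := wt (true, true, false); have := wt (false, false, true).
have := wt (true, false, true); have := wt (false, true, true).
have := wt (true, true, true).
rewrite !big_bvec !big_cons !big_nil /plane_bounds /=.
do 7!move=> /(_ isT) ?.
move: {wt} nE; lia.
Qed.

(* The value [n_2(3, d)] of the Griesmer bound [d + ceil(d/2) + ceil(d/4)]. *)
Definition griesmer3 (d : nat) : nat :=
  (7 * (d %/ 4) + nth 0 [:: 0; 3; 4; 6] (d %% 4))%N.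

(* Adding the bounds for the three planes through the point [p] gives
   [2 x p <= 2 n - 3 d]: if [n] were too small, the seven [x p] could not sum
   up to the length. *)
Lemma code_griesmer3 n d (C : {vspace 'rV['F_2]_n}) :
  is_code 3 d C -> (griesmer3 d <= n)%N.
Proof.
move=> /code_plane_bounds[x1[x2[x3[x4[x5[x6[x7 [pb _]]]]]]]].
case: pb => [nx [h1 [h2 [h3 [h4 [h5 [h6 h7]]]]]]].
have b1 : (2 * x1 + 3 * d <= 2 * n)%N by lia.
have b2 : (2 * x2 + 3 * d <= 2 * n)%N by lia.
have b3 : (2 * x3 + 3 * d <= 2 * n)%N by lia.
have b4 : (2 * x4 + 3 * d <= 2 * n)%N by lia.
have b5 : (2 * x5 + 3 * d <= 2 * n)%N by lia.
have b6 : (2 * x6 + 3 * d <= 2 * n)%N by lia.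
have b7 : (2 * x7 + 3 * d <= 2 * n)%N by lia.
(* If [n] is below the bound, rounding makes each multiplicity smaller than [d / 4]. But each point
   lies off four of the seven lines, so the weight bounds add up to four times the sum of the
   multiplicities being at least [7 * d]. *)
rewrite /griesmer3; have := ltn_pmod d (isT : 0 < 4)%N.
have := divn_eq d 4; case: (d %% 4)%N => [|[|[|[|]]]] //= dE _; lia.
Qed.

(** * Construction of codes from periodic columns *)

Lemma card_ord_modn (p t s : nat) (P : pred nat) : (s < p)%N ->
  #|[set i : 'I_(t * p + s) | P (i %% p)%N]| =
  (t * count P (iota 0 p) + count P (iota 0 s))%N.
Proof.
move=> lt_sp; have p_gt0 : (0 < p)%N by apply: leq_ltn_trans lt_sp.
rewrite cardsE cardE size_filter.
rewrite (_ : count _ _ = count (fun i => P (i %% p)%N) (iota 0 (t * p + s))); last first.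
  by rewrite -val_enum_ord count_map enumT; apply: eq_count => i.
have mod_iota m r : (r <= p)%N ->
    count (fun i => P (i %% p)%N) (iota (m * p) r) = count P (iota 0 r).
  move=> le_rp; rewrite -[(m * p)%N]addn0 iotaDl count_map.
  apply: eq_in_count => i; rewrite mem_iota /= add0n => lt_ir.
  by rewrite modnMDl modn_small // (leq_trans lt_ir).
rewrite iotaD count_cat add0n mod_iota ?(ltnW lt_sp) //; congr (_ + _)%N.
elim: t => [|t IHt]; first by rewrite mul0n.
by rewrite !mulSnr iotaD count_cat add0n IHt mod_iota.
Qed.

Section CodeOfColumns.

Variables (n : nat) (col : 'I_n -> bvec).

Let G : 'M['F_2]_(3, n) := \matrix_(k, i) (bvec_nth (col i) k)%:R.

Let bvec_of (a : 'rV['F_2]_3) : bvec :=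
  (a ord0 0 != 0, a ord0 1 != 0, a ord0 (2%:R) != 0).

Let bvec_of_neq0 (a : 'rV['F_2]_3) : a != 0 -> bvec_of a != bvec0.
Proof.
apply: contra => /eqP[/negbFE/eqP a0 /negbFE/eqP a1 /negbFE/eqP a2].
apply/eqP/rowP => i; rewrite mxE.
have : i \in [:: 0; 1; 2%:R] by case: i => [[|[|[|]]]].
by rewrite !inE => /or3P[] /eqP->.
Qed.

Let mulG_coor a i : ((a *m G) ord0 i != 0) = bdot (bvec_of a) (col i).
Proof.
rewrite mxE !big_ord_recl big_ord0 addr0 !F2_neq0D !F2_neq0M !mxE !F2_nat_bool.
rewrite /bdot /bvec_of /bvec_nth /= addbA.
by congr (_ && _ (+) _ && _ (+) _ && _); congr (a _ _ != 0); apply: val_inj.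
Qed.

Lemma code_of_columns d : (0 < d)%N ->
    (forall a, a != bvec0 -> d <= #|[set i | bdot a (col i)]|)%N ->
    (forall i, exists2 j, j != i & col j = col i) ->
  exists C : {vspace 'rV['F_2]_n}, is_code 3 d C /\ has_locality C 1.
Proof.
move=> d_gt0 wt rep; pose f := linfun (mulmxr G : 'rV_3 -> 'rV_n).
have fE a : f a = a *m G by rewrite lfunE.
have f_wt (a : 'rV['F_2]_3) : a != 0 -> (d <= #|[set i | (a *m G) ord0 i != 0%R]|)%N.
  move=> /bvec_of_neq0/wt.
  by under [in X in _ -> X]eq_finset => i do rewrite mulG_coor.
exists (limg f); split; first split.
(* The encoding is injective because a nonzero message is sent to a word of positive weight. *)
- rewrite limg_dim_eq ?dimvf //=; apply/eqP; rewrite -subv0.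
  apply/subvP => a; rewrite memv_cap memvf memv_ker fE memv0 /= => /eqP aG.
  apply: contraLR d_gt0 => /f_wt; rewrite aG -leqNgt.
  rewrite (_ : [set _ | _] = set0) ?cards0 //.
  by apply/setP => i; rewrite !inE mxE eqxx.
- move=> _ _ /memv_imgP[a _ ->] /memv_imgP[c _ ->] neq_ac.
  have /f_wt : a - c != 0 by rewrite subr_eq0; apply: contraNneq neq_ac => ->.
  rewrite mulmxBl /hamming_dist !fE.
  have subE (x y : 'rV['F_2]_n) i : ((x - y) ord0 i != 0) = (x ord0 i != y ord0 i).
    by rewrite !mxE subr_eq0.
  by under eq_finset => i do rewrite subE.
- move=> i; have [j neq_ji col_ji] := rep i; exists [set j].
  rewrite inE eq_sym cards1; split=> // _ _ /memv_imgP[a _ ->] /memv_imgP[c _ ->].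
  move=> /(_ j (set11 j)); rewrite !fE => eq_j.
  by apply: F2_neq0_inj; rewrite !mulG_coor -col_ji -!mulG_coor eq_j.
Qed.

End CodeOfColumns.

(* Ordered so that the first 3, 4, 6 and 7 columns generate codes of minimum
   distance 1, 2, 3 and 4, the largest possible values. *)
Definition columns : seq bvec :=
  [:: (true, false, false); (false, true, false); (false, false, true);
      (true, true, true); (true, true, false); (true, false, true);
      (false, true, true)].

(** At least two full periods repeat every column, which gives locality 1; the weights of the
    periods and of the remaining prefix add up. *)
Lemma cyclic_code (p t s d : nat) : (0 < d)%N -> (1 < t)%N -> (s < p)%N ->
    (forall a, a != bvec0 ->
       d <= t * count (fun i => bdot a (nth bvec0 columns i)) (iota 0 p)
          + count (fun i => bdot a (nth bvec0 columns i)) (iota 0 s))%N ->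
  exists C : {vspace 'rV['F_2]_(t * p + s)}, is_code 3 d C /\ has_locality C 1.
Proof.
move=> d_gt0 t_gt1 lt_sp wt.
pose col (i : 'I_(t * p + s)) := nth bvec0 columns (i %% p).
apply: (@code_of_columns _ col) => // [a a0|i].
  by rewrite (card_ord_modn t (fun i => bdot a (nth bvec0 columns i))) ?wt.
have p2 : (2 * p <= t * p)%N by rewrite leq_mul2r t_gt1 orbT.
(* The second occurrence lies one period later for [i] in the first period, and one period earlier
   otherwise. *)
have [lt_ip|le_pi] := ltnP i p.
  have lt_j : (i + p < t * p + s)%N by lia.
  exists (Ordinal lt_j); last by rewrite /col /= modnDr.
  by rewrite -val_eqE /=; lia.
have lt_j : (i - p < t * p + s)%N by have := ltn_ord i; lia.
exists (Ordinal lt_j); last by rewrite /col /= -[in RHS](subnK le_pi) modnDr.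
by rewrite -val_eqE /=; lia.
Qed.

(** * Exact values of the minimum length *)

Lemma min_length_locI d n :
    (exists C : {vspace 'rV['F_2]_n}, is_code 3 d C /\ has_locality C 1) ->
    (forall m x1 x2 x3 x4 x5 x6 x7, plane_bounds m d x1 x2 x3 x4 x5 x6 x7 ->
       all (fun x => x != 1)%N [:: x1; x2; x3; x4; x5; x6; x7] -> (n <= m)%N) ->
  min_length_loc 'F_2 3 d 1 n.
Proof.
move=> exC lower; split=> // m [C [codeC locC]].
have [x1[x2[x3[x4[x5[x6[x7 [pb loc]]]]]]]] := code_plane_bounds codeC.
exact: lower pb (loc locC).
Qed.

Ltac solve_lower :=
  move=> m x1 x2 x3 x4 x5 x6 x7 [? [? [? [? [? [? [? ?]]]]]]] /=;
  move=> /and5P[? ? ? ? /and4P[? ? ? _]]; lia.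

Ltac solve_weights := by move=> [[[] []] []].

Local Close Scope ring_scope.

Theorem theorem36 :
  (min_length_loc 'F_2 3 1 1 6 /\ min_length_loc 'F_2 3 2 1 6) /\
  (min_length_loc 'F_2 3 3 1 8 /\ min_length_loc 'F_2 3 4 1 8) /\
  min_length_loc 'F_2 3 5 1 11 /\
  min_length_loc 'F_2 3 6 1 12 /\
  min_length_loc 'F_2 3 7 1 14 /\
  (forall d : nat, 8 <= d ->
     exists n : nat, min_length_loc 'F_2 3 d 1 n /\ min_length 'F_2 3 d n).
Proof.
split; [split|split; [split|split; [|split; [|split]]]].
- apply: min_length_locI; last by solve_lower.
  by apply: (@cyclic_code 3 2 0) => //; solve_weights.
- apply: min_length_locI; last by solve_lower.
  by apply: (@cyclic_code 3 2 0) => //; solve_weights.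
- apply: min_length_locI; last by solve_lower.
  by apply: (@cyclic_code 4 2 0) => //; solve_weights.
- apply: min_length_locI; last by solve_lower.
  by apply: (@cyclic_code 4 2 0) => //; solve_weights.
- apply: min_length_locI; last by solve_lower.
  (* Two periods of four columns contribute distance 4, and the three leftover columns contribute
     1. *)
  by apply: (@cyclic_code 4 2 3) => //; solve_weights.
- apply: min_length_locI; last by solve_lower.
  by apply: (@cyclic_code 6 2 0) => //; solve_weights.
- apply: min_length_locI; last by solve_lower.
  by apply: (@cyclic_code 7 2 0) => //; solve_weights.
move=> d d_ge8; exists (griesmer3 d).
have [C [codeC locC]] : exists C : {vspace 'rV['F_2]_(griesmer3 d)},
    is_code 3 d C /\ has_locality C 1.
  (* For [d >= 8] the code consists of at least two copies of the seven columns, each of weight 4,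
     followed by a prefix of length 0, 3, 4 or 6 that contributes [d %% 4]. *)
  have t_gt1 : (1 < d %/ 4)%N by rewrite leq_divRL.
  have d_gt0 : (0 < d)%N by apply: leq_trans d_ge8.
  rewrite /griesmer3 mulnC; have := ltn_pmod d (isT : 0 < 4)%N.
  have := divn_eq d 4.
  case: (d %% 4)%N => [|[|[|[|]]]] //= dE _;
    apply: cyclic_code => // -[[[] []] []] //= _; lia.
split; split.
- by exists C.
- by move=> m [C' [/code_griesmer3]].
- by exists C.
- by move=> m [C' /code_griesmer3].
Qed.
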